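(* Suppose that the following condition is satisfied: $\mathfrak{X}$ has a compatible metric $\mathfrak{d}$ under which there exists a decreasing sequence $(\delta_n)_n$ of strictly positive numbers such that $\inf_n\delta_n=0$, $\mathfrak{m}\{y\in\mathfrak{X}:\mathfrak{d}(x,y)=\delta_n\}=0$ for every $n$ and every $x\in\mathfrak{X}$, and, in addition, $\mathfrak{m}(\mathcal{B}_{x,\delta_n})=\mathfrak{m}(\mathcal{B}_{y,\delta_n})$ for every $n$ and every $x,y\in\mathfrak{X}$. Then $\mathcal{M}$ has a two-sided norm-approximate unit.
   Context: $\mathfrak{X}$ is a fixed compact metrizable space and $\mathfrak{m}$ is a fixed Borel probability measure on $\mathfrak{X}$ whose support is all of $\mathfrak{X}$. $\mathcal{M}=\mathcal{M}_{\mathfrak{X},\mathfrak{m}}$ denotes the Banach $*$-algebra $\mathbf{C}(\mathfrak{X}^2)$ of continuous complex functions on $\mathfrak{X}\times\mathfrak{X}$ with the supremum norm, the multiplication $(f\star g)(x,y)=\int_{\mathfrak{X}}f(x,z)g(z,y)\,d\mathfrak{m}(z)$ and the involution $f^*(x,y)=\overline{f(y,x)}$. A compatible metric is one inducing the topology of $\mathfrak{X}$, and $\mathcal{B}_{x,\delta}$ is the open $\mathfrak{d}$-ball with center $x$ and radius $\delta$. A two-sided norm-approximate unit for $\mathcal{M}$ is a net $(u_\lambda)_\lambda$ in $\mathcal{M}$ such that $a\star u_\lambda\to a$ and $u_\lambda\star a\to a$ in norm for every $a\in\mathcal{M}$ (no boundedness of the net is required). *)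

(* Defs.v *)
From HB Require Import structures.
From mathcomp Require Import all_boot all_order all_algebra.
From mathcomp Require Import all_classical all_reals all_analysis.
From mathcomp Require Import complex.
Set Implicit Arguments.
Unset Strict Implicit.
Unset Printing Implicit Defensive.
Import Order.TTheory GRing.Theory Num.Theory.
Import numFieldTopology.Exports numFieldNormedType.Exports.
Local Open Scope classical_set_scope.
Local Open Scope ring_scope.
Local Open Scope complex_scope.

Section metrics.
Context {R : realType} {X : topologicalType}.
Implicit Type d : X -> X -> R.

Definition is_metric d : Prop :=
  [/\ forall x y, 0 <= d x y,
      forall x y, d x y = 0 <-> x = y,
      forall x y, d x y = d y x &
      forall x y z, d x z <= d x y + d y z].

Definition mball d (x : X) (r : R) : set X := [set y | d x y < r].

Definition compatible_metric d : Prop :=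
  is_metric d /\
  forall A : set X, open A <->
    forall x, A x -> exists2 r : R, 0 < r & mball d x r `<=` A.

End metrics.

Definition metrizable (R : realType) (X : topologicalType) : Prop :=
  exists d : X -> X -> R, compatible_metric d.

(* [X] with its Borel sigma-algebra. Measurable types being pointed, so is [X];
   this costs nothing, as a space carrying a probability is nonempty. *)
Notation borel X := (g_sigma_algebraType (@open X)).

(* The carrier of the algebra is [cont_kernel R X]; the alias [R[i]^o] of [R[i]] is the
   one that the library equips with the topology of the modulus. The product and
   the norm are set up on bare functions; on continuous functions over a compact
   [X] the integrals and the supremum below are finite and the product is
   again continuous. *)
Definition cont_kernel (R : realType) (X : ptopologicalType) : Type :=
  continuousType (X * X)%type R[i]^o.

Section kernel_algebra.
Context {R : realType} {X : ptopologicalType}.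
Implicit Type m : probability (borel X) R.

Definition measure_support m : set X :=
  [set x | forall U : set X, open_nbhs x U -> (0 < m U)%E].

Definition Cintegral m (h : X -> R[i]) : R[i] :=
  (\int[m]_(z in setT) complex.Re (h z)) +i*
  (\int[m]_(z in setT) complex.Im (h z)).

Definition kernel_mul m (f g : X * X -> R[i]) : X * X -> R[i] :=
  fun p => Cintegral m (fun z => f (p.1, z) * g (z, p.2)).

Definition sup_norm (f : X * X -> R[i]) : R :=
  sup [set Normc.normc (f p) | p in setT].

End kernel_algebra.

Definition directed (L : Type) (le : L -> L -> Prop) : Prop :=
  [/\ inhabited L,
      forall i, le i i,
      forall i j k, le i j -> le j k -> le i k &
      forall i j, exists2 k, le i k & le j k].

(* Convergence of a net is convergence along the filter generated by the tails
   of its index set. *)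
Definition tails (L : Type) (le : L -> L -> Prop) : set_system L :=
  filter_from [set: L] (fun i => [set j | le i j]).

Definition two_sided_approximate_unit (R : realType) (X : ptopologicalType)
    (m : probability (borel X) R) (L : Type) (le : L -> L -> Prop)
    (u : L -> cont_kernel R X) : Prop :=
  directed le /\
  forall a : cont_kernel R X,
    (sup_norm (kernel_mul m a (u l) \- a) @[l --> tails le] --> (0 : R)) /\
    (sup_norm (kernel_mul m (u l) a \- a) @[l --> tails le] --> (0 : R)).

(* Main.v *)
Require Import Defs.
From HB Require Import structures.
From mathcomp Require Import all_boot all_order all_algebra.
From mathcomp Require Import all_classical all_reals all_analysis.
From mathcomp Require Import complex lra.
Set Implicit Arguments.
Unset Strict Implicit.
Unset Printing Implicit Defensive.
Import Order.TTheory GRing.Theory Num.Theory.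
Import numFieldTopology.Exports numFieldNormedType.Exports.
Import measurable_realfun.
Local Open Scope classical_set_scope.
Local Open Scope ring_scope.

(* The normalised indicators of the balls of radius delta_n would form an
   approximate unit, were they continuous.  Since all balls of radius delta_n
   have the same mass c > 0 and X is compact, some radius r < delta_n satisfies
   m (B(x, r)) > c (1 - eta) for all x at once.  The kernel (1/c) h(d x y), with h
   piecewise linear, equal to 1 on [0, r] and to 0 beyond delta_n, is then
   continuous and symmetric, and its marginals lie between 1 - eta and 1.
   Multiplying a by it on the right averages a over small balls in the second
   variable, so that uniform continuity of a gives the uniform convergence;
   the left products reduce to the right ones by transposition. *)

(** * Continuous functions on a compact space: measurability, bounds, averages *)

Lemma continuous_borel_measurable (R : realType) (X : ptopologicalType)
    (f : X -> R) :
  continuous f -> measurable_fun [set: borel X] (f : borel X -> R).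
Proof.
move=> /continuousP f_cont.
apply: (measurability _ (RGenOpens.measurableE R)).
move=> _ [_ [a [b ->]] <-]; rewrite setTI.
by apply: sub_sigma_algebra; apply: f_cont; exact: interval_open.
Qed.

Lemma compact_continuous_bounded (R : realType) (T : topologicalType)
    (f : T -> R) :
  compact [set: T] -> continuous f -> exists2 M, 0 <= M & forall t, `|f t| <= M.
Proof.
move=> T_compact f_cont.
have /compact_bounded [M0 [_ M0P]] : compact (f @` [set: T]).
  by apply: continuous_compact => //; exact: continuous_subspaceT.
exists (`|M0| + 1) => [|t]; first by rewrite addr_ge0.
by apply: M0P; [rewrite ltr_pwDr// ler_norm|exists t].
Qed.

Lemma continuous_integrable (R : realType) (X : ptopologicalType)
    (m : probability (borel X) R) (f : X -> R) :
  compact [set: X] -> continuous f ->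
  m.-integrable [set: borel X] (EFin \o f).
Proof.
move=> X_compact f_cont; apply: measurable_bounded_integrable => //.
- exact: le_lt_trans (probability_le1 m measurableT) (ltry _).
- exact: continuous_borel_measurable.
- have [M _ fM] := compact_continuous_bounded X_compact f_cont.
  by exists M; split => [|N MN t _]; [exact: num_real|exact: le_trans (fM t) (ltW MN)].
Qed.

(** The error is the integral of [(g - c) * w] plus [c * (I - 1)], with [I] the mass of [w]. The
    first term is at most [e * I <= e], because [g] is within [e] of [c] wherever [w] does not
    vanish; the second is at most [M * eta], because [I] lies between [1 - eta] and [1]. *)
Lemma weighted_average_error (R : realType) (X : ptopologicalType)
    (m : probability (borel X) R) (g w : X -> R) (c e eta M : R) :
  compact [set: X] -> continuous g -> continuous w ->
  (forall z, 0 <= w z) -> 0 <= e ->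
  (forall z, w z != 0 -> `|g z - c| <= e) -> `|c| <= M ->
  1 - eta <= \int[m]_(z in [set: borel X]) w z <= 1 ->
  `|\int[m]_(z in [set: borel X]) (g z * w z) - c| <= e + M * eta.
Proof.
move=> X_compact g_cont w_cont w_ge0 e_ge0 gc cM /andP[w_lower w_upper].
set I := \int[m]_(z in _) w z in w_lower w_upper.
have int_w := continuous_integrable m X_compact w_cont.
have gcw_cont : continuous (fun z => (g z - c) * w z).
  move=> z; apply: cvgM; last exact: w_cont.
  by apply: cvgB; [exact: g_cont|exact: cvg_cst].
have int_gcw := continuous_integrable m X_compact gcw_cont.
have cw_cont (r : R) : continuous (fun z => r * w z).
  by move=> z; apply: cvgM; [exact: cvg_cst|exact: w_cont].
have int_cw r := continuous_integrable m X_compact (cw_cont r).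
have -> : \int[m]_(z in [set: borel X]) (g z * w z) - c =
    \int[m]_(z in [set: borel X]) ((g z - c) * w z) + c * (I - 1).
  rewrite mulrBr mulr1 addrA; congr (_ - _).
  rewrite -RintegralZl// -RintegralD//.
  by apply: eq_Rintegral => z _; rewrite -mulrDl subrK.
apply: le_trans (ler_normD _ _) _; apply: lerD.
  apply: le_trans (le_normr_Rintegral _ _) _ => //.
  apply: (@le_trans _ _ (\int[m]_(z in [set: borel X]) (e * w z))).
    apply: le_Rintegral => //.
      exact: integrable_norm.
    move=> z _; rewrite normrM (ger0_norm (w_ge0 z)).
    have [->|wz] := eqVneq (w z) 0; first by rewrite !mulr0.
    by rewrite ler_wpM2r// gc.
  by rewrite RintegralZl// ler_piMr.
rewrite normrM ler_pM// distrC ger0_norm ?subr_ge0//.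
by rewrite lerBlDr addrC -lerBlDr.
Qed.

(** * Balls of a compatible metric: topology, uniform continuity and measure *)

Lemma mball_open (R : realType) (X : topologicalType) (d : X -> X -> R)
    (x : X) (r : R) :
  compatible_metric d -> open (mball d x r).
Proof.
move=> [[_ _ _ d_tri] d_open]; apply/d_open => y xy.
exists (r - d x y); first by rewrite subr_gt0.
by move=> z /= yz; apply: le_lt_trans (d_tri x y z) _; rewrite addrC -ltrBrDr.
Qed.

Lemma mball_measurable (R : realType) (X : ptopologicalType) (d : X -> X -> R)
    (x : X) (r : R) :
  compatible_metric d -> measurable (mball d x r : set (borel X)).
Proof. by move=> dP; apply: sub_sigma_algebra; exact: mball_open. Qed.

Lemma mball_nbhs (R : realType) (X : topologicalType) (d : X -> X -> R)
    (x : X) (r : R) :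
  compatible_metric d -> 0 < r -> nbhs x (mball d x r).
Proof.
move=> dP r_gt0; apply: open_nbhs_nbhs; split; first exact: mball_open.
by case: dP => -[_ /(_ x x)[_ dxx] _ _] _; rewrite /mball /= dxx.
Qed.

Lemma nbhs_mball (R : realType) (X : topologicalType) (d : X -> X -> R)
    (x : X) (A : set X) :
  compatible_metric d -> nbhs x A -> exists2 r, 0 < r & mball d x r `<=` A.
Proof.
move=> [_ d_open]; rewrite nbhsE => -[B [/d_open B_open Bx] BA].
by have [r r_gt0 rB] := B_open x Bx; exists r => //; exact: subset_trans BA.
Qed.

Lemma metric_continuous (R : realType) (X : topologicalType) (d : X -> X -> R) :
  compatible_metric d -> continuous (fun p : X * X => d p.1 p.2).
Proof.
move=> dP [x y]; apply/cvgrPdist_lt => e e_gt0.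
have e2_gt0 : 0 < e / 2 by rewrite divr_gt0.
exists (mball d x (e / 2), mball d y (e / 2)).
  by split; exact: mball_nbhs.
move=> [x' y'] [/=]; rewrite /mball /= => xx' yy'.
case: dP => -[d_ge0 d0 d_sym d_tri] _.
have := d_tri x x' y; have := d_tri x' y' y.
have := d_tri x' x y'; have := d_tri x y y'.
rewrite (d_sym x' x) (d_sym y' y) => *.
by rewrite ltr_norml; apply/andP; split; lra.
Qed.

(** Compactness of [X * X] enters as a near-covering property along [0^'+]: if all small radii work
    near each point, then all small radii work for every point at once. *)
Lemma uniformly_continuous_snd (R : realType) (X : topologicalType)
    (d : X -> X -> R) (g : X * X -> R) (e : R) :
  compact [set: X] -> compatible_metric d -> continuous g -> 0 < e ->
  exists2 r, 0 < r & forall x y z, d y z < r -> `|g (x, z) - g (x, y)| <= e.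
Proof.
move=> X_compact dP g_cont e_gt0.
have e2_gt0 : 0 < e / 2 by rewrite divr_gt0.
have /compact_near_coveringP cover := compact_setX X_compact X_compact.
pose P r (p : X * X) :=
  forall z, d p.2 z < r -> `|g (p.1, z) - g p| <= e.
have [[x y] _|r [r_gt0 rP]] := cover R 0^'+ P _; last first.
  (* The covering property holds for positive radii at distance less than [r] from 0, hence the
     choice of [r / 2]. *)
  exists (r / 2); first by rewrite divr_gt0.
  move=> x y z yz; apply: (rP (r / 2) _ _ (x, y)) => //=.
  - by rewrite sub0r normrN gtr0_norm ?divr_gt0// ltr_pdivrMr// ltr_pMr// ltr1n.
  - by rewrite divr_gt0.
have /cvgrPdist_lt/(_ _ e2_gt0) [[A B] [/= Ax By] ABg] := g_cont (x, y).
have [s s_gt0 sB] := nbhs_mball dP By.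
(* With [y'] within [s / 2] of [y] and [z] within [s / 2] of [y'], both lie in the [s]-ball at [y],
   so both values of [g] can be compared with [g (x, y)]. *)
have s2_gt0 : 0 < s / 2 by rewrite divr_gt0.
exists (A `*` mball d y (s / 2), [set r | r < s / 2]) => /=.
  split; last exact: nbhs_right_lt.
  by exists (A, mball d y (s / 2)) => //; split => //; exact: mball_nbhs.
move=> [[x' y'] r] [/= [Ax' yy'] rs] z y'z; rewrite /mball/= in yy' y'z.
case: dP => -[_ _ _ d_tri] _; have := d_tri y y' z => yz.
have g1 := ABg (x', y') (conj Ax' (sB y' _)).
have g2 := ABg (x', z) (conj Ax' (sB z _)).
rewrite /mball/= in g1 g2.
have -> : g (x', z) - g (x', y') = (g (x, y) - g (x', y')) - (g (x, y) - g (x', z)) by lra.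
apply: le_trans (ler_normB _ _) _.
rewrite [leRHS]splitr; apply: lerD; apply: ltW; [apply: g1|apply: g2]; lra.
Qed.

(** An open ball is the increasing union of the concentric balls of radii [delta - 1/(k+1)], and the
    measure is continuous from below. *)
Lemma mball_inner_measure (R : realType) (X : ptopologicalType)
    (m : probability (borel X) R) (d : X -> X -> R) (x : X) (delta b : R) :
  compatible_metric d -> (b%:E < m (mball d x delta))%E ->
  exists2 r, r < delta & (b%:E < m (mball d x r))%E.
Proof.
move=> dP bm; pose F k : set (borel X) := mball d x (delta - k.+1%:R^-1).
have mF r := mball_measurable x r dP.
have FE : \bigcup_k F k = mball d x delta.
  apply/seteqP; split => [y [k _]|y]; rewrite /F /mball /=.
    by move=> /lt_le_trans; apply; rewrite gerBl.
  (* This [k] satisfies [k + 1 > 1 / (delta - d x y)], so that [d x y < delta - 1/(k+1)]. *)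
  rewrite -subr_gt0 => xy; exists (Num.truncn (delta - d x y)^-1) => //=.
  rewrite ltrBrDr addrC -ltrBrDr invf_plt ?posrE//.
  exact: truncnS_gt.
have := @nondecreasing_cvg_mu _ _ _ m F (fun=> mF _).
rewrite FE => /(_ (mF _)) cvF.
have /cvF : nbhs (m (mball d x delta)) [set t | (b%:E < t)%E].
  by apply: open_nbhs_nbhs; split => //; exact: open_ereal_gt_ereal.
case=> [|k _ /(_ k (leqnn k)) bk].
  move=> i j ij; apply/subsetPset => y /lt_le_trans; apply.
  by rewrite lerD2l lerN2 lef_pV2 ?posrE// ler_nat.
exists (delta - k.+1%:R^-1) => //.
by rewrite ltrBlDr ltrDl.
Qed.

(** A radius [r] good at [x] stays good nearby after a slight increase: by the triangle inequality,
    the ball at [x'] of radius more than [r + (delta - r) / 2] contains the [r]-ball at [x] once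
    [x'] is within [(delta - r) / 2] of [x]. Compactness along [delta^'-] then yields one radius for
    all points. *)
Lemma uniform_mball_inner_measure (R : realType) (X : ptopologicalType)
    (m : probability (borel X) R) (d : X -> X -> R) (delta b : R) :
  compact [set: X] -> compatible_metric d ->
  (forall x, (b%:E < m (mball d x delta))%E) ->
  exists2 r, r < delta & forall x, (b%:E < m (mball d x r))%E.
Proof.
move=> X_compact dP bm.
have mF x r := mball_measurable x r dP.
have /compact_near_coveringP cover := X_compact.
pose P r x := (b%:E < m (mball d x r))%E.
have [x _|] := cover R delta^'- P _; last first.
  move=> s /= s_gt0 sP; exists (delta - s / 2).
    by rewrite gtrBl divr_gt0.
  move=> x; apply: (sP (delta - s / 2)) => //=; last first.
    by rewrite gtrBl divr_gt0.
  rewrite opprB addrC subrK gtr0_norm ?divr_gt0// ltr_pdivrMr//.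
  by rewrite ltr_pMr// ltr1n.
have [r r_delta bmr] := mball_inner_measure dP (bm x).
have s_gt0 : 0 < (delta - r) / 2 by rewrite divr_gt0// subr_gt0.
exists (mball d x ((delta - r) / 2), [set i | r + (delta - r) / 2 < i]) => /=.
  by split; [exact: mball_nbhs|apply: nbhs_left_gt; lra].
move=> [x' i] [/=]; rewrite /mball/= => xx' ri.
apply: lt_le_trans bmr _; apply: le_measure; rewrite ?inE; [exact: mF..|].
move=> y; rewrite /mball/= => xy.
case: dP => -[_ _ d_sym d_tri] _; have := d_tri x' x y.
rewrite (d_sym x' x) => ?; lra.
Qed.

(** * Construction of symmetric weights concentrated near the diagonal *)

Lemma Rintegral_indicT (R : realType) (disp : measure_display)
    (T : measurableType disp) (m : probability T R) (A : set T) :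
  measurable A -> \int[m]_(t in [set: T]) \1_A t = fine (m A).
Proof. by move=> mA; rewrite /Rintegral integral_indic// setIT. Qed.

(** Weights are kept real, to be cast into [R[i]] only in products. Bounds on one marginal suffice,
    since symmetry transfers them to the other. *)
Definition is_weight (R : realType) (X : ptopologicalType)
    (m : probability (borel X) R) (d : X -> X -> R) (delta eta : R)
    (w : X * X -> R) : Prop :=
  [/\ continuous w, forall p, 0 <= w p, forall x y, w (x, y) = w (y, x),
      forall x y, w (x, y) != 0 -> d x y < delta &
      forall x, 1 - eta <= \int[m]_(z in [set: borel X]) w (x, z) <= 1].

(** Equality of the ball measures is what allows a single normalising constant [c], hence a
    symmetric kernel; full support makes [c] positive. *)
Lemma approximate_unit_weight (R : realType) (X : ptopologicalType)
    (m : probability (borel X) R) (d : X -> X -> R) (delta eta : R) :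
  compact [set: X] -> measure_support m = [set: X] -> compatible_metric d ->
  (forall x y, m (mball d x delta) = m (mball d y delta)) ->
  0 < delta -> 0 < eta ->
  exists w : X * X -> R, is_weight m d delta eta w.
Proof.
move=> X_compact m_support dP m_const delta_gt0 eta_gt0.
have mF x r := mball_measurable x r dP.
pose c := fine (m (mball d point delta)).
have cE x : m (mball d x delta) = c%:E.
  by rewrite (m_const x point) fineK// fin_num_measure.
have c_gt0 : 0 < c.
  rewrite -lte_fin -(cE point).
  have : measure_support m point by rewrite m_support.
  apply; split; first exact: mball_open.
  by case: dP => -[_ /(_ point point)[_ d0] _ _] _; rewrite /mball/= d0.
have bm x : ((c * (1 - eta))%:E < m (mball d x delta))%E.
  by rewrite cE lte_fin mulrBr mulr1 gtrBl mulr_gt0.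
have [r r_delta rm] := uniform_mball_inner_measure X_compact dP bm.
have dr_gt0 : 0 < delta - r by rewrite subr_gt0.
(* As a function of the distance, [q] is affine with value 1 at [r] and 0 at [delta]; [h] is its
   truncation to the interval from 0 to 1. *)
pose q (p : X * X) := (delta - d p.1 p.2) / (delta - r).
pose h : X * X -> R := (fun=> 0) \max ((fun=> 1) \min q).
have h_cont : continuous h.
  have q_cont : continuous q.
    move=> p; apply: cvgM; last exact: cvg_cst.
    by apply: cvgB; [exact: cvg_cst|exact: (metric_continuous dP)].
  apply: max_fun_continuous; first exact: cst_continuous.
  by apply: min_fun_continuous => //; exact: cst_continuous.
have h_ge0 p : 0 <= h p by rewrite le_max lexx.
have h_le1 p : h p <= 1 by rewrite ge_max ler01 ge_min lexx.
have h_out x y : ~ d x y < delta -> h (x, y) = 0.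
  move=> /negP; rewrite -leNgt => xy; apply/max_idPl.
  by rewrite /= ge_min /q pmulr_lle0 ?invr_gt0// subr_le0 xy orbT.
have h_in x y : d x y < r -> h (x, y) = 1.
  move=> xy; apply/eqP; rewrite eq_le h_le1 le_max le_min lexx /= /q/=.
  by rewrite ler_pdivlMr// mul1r lerD2l lerN2 (ltW xy) orbT.
have hx_cont x : continuous (fun z => h (x, z)).
  move=> z; apply: (@continuous_comp _ _ _ (fun z => (x, z)) h); last exact: h_cont.
  by apply: cvg_pair; [exact: cvg_cst|exact: cvg_id].
have int_h x := continuous_integrable m X_compact (hx_cont x).
have int_1 x s : m.-integrable [set: borel X] (EFin \o \1_(mball d x s : set (borel X))).
  exact: integrable_indic.
exists (fun p => c^-1 * h p); split.
- by move=> p; apply: cvgM; [exact: cvg_cst|exact: h_cont].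
- by move=> p; rewrite mulr_ge0// invr_ge0 ltW.
- by move=> x y; case: dP => -[_ _ d_sym _] _; rewrite /h/= /q/= d_sym.
- move=> x y; apply: contra_neqT => /negP xy.
  by rewrite h_out ?mulr0.
(* The section of [h] at [x] lies between the indicators of the balls of radii [r] and [delta],
   whose integrals are more than [c * (1 - eta)] and equal to [c]. *)
- move=> x; rewrite RintegralZl//; apply/andP; split.
    rewrite ler_pdivlMl//.
    apply: (@le_trans _ _ (fine (m (mball d x r)))).
      by rewrite -lee_fin fineK ?fin_num_measure// ltW.
    rewrite -(Rintegral_indicT m (mF _ _)); apply: le_Rintegral => // z _.
    by rewrite indicE; have [/set_mem/h_in ->|_] := boolP (z \in _).
  have c_x : c = fine (m (mball d x delta)) by rewrite cE.
  rewrite ler_pdivrMl// mulr1 c_x -(Rintegral_indicT m (mF _ _)).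
  apply: le_Rintegral => // z _.
  rewrite indicE; have [_|/negP xz] := boolP (z \in _); first exact: h_le1.
  by rewrite h_out// => ?; apply: xz; exact: mem_set.
Qed.

(** * Complex kernels: moduli, continuity and products with a weight *)

Local Open Scope complex_scope.

Lemma normr_normc (R : rcfType) (z : R[i]) : `|z| = (Normc.normc z)%:C.
Proof. by []. Qed.

Lemma normc_le_abs_Re_Im (R : rcfType) (z : R[i]) :
  Normc.normc z <= `|complex.Re z| + `|complex.Im z|.
Proof.
case: z => a b /=.
rewrite -[leRHS]ger0_norm ?addr_ge0// -[leRHS]sqrtr_sqr ler_wsqrtr//.
by rewrite sqrrD !real_normK ?num_real// lerD2r lerDl mulrn_wge0// mulr_ge0.
Qed.

Lemma abs_Im_le_normc (R : rcfType) (z : R[i]) :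
  `|complex.Im z| <= Normc.normc z.
Proof.
by case: z => a b /=; rewrite -sqrtr_sqr ler_wsqrtr// lerDr sqr_ge0.
Qed.

Lemma abs_Re_le_normc (R : rcfType) (z : R[i]) :
  `|complex.Re z| <= Normc.normc z.
Proof.
by case: z => a b /=; rewrite -sqrtr_sqr ler_wsqrtr// lerDl sqr_ge0.
Qed.

Lemma Re_Im_continuous (R : realType) (T : topologicalType) (f : T -> R[i]^o) :
  continuous f ->
  continuous (fun t => complex.Re (f t)) /\ continuous (fun t => complex.Im (f t)).
Proof.
move=> f_cont; split => t; apply/cvgrPdist_lt => e e_gt0.
  have /cvgrPdist_lt/(_ e%:C) : f s @[s --> t] --> f t by exact: f_cont.
  rewrite ltcR => /(_ e_gt0); apply: filterS => s /=.
  rewrite normr_normc ltcR; apply: le_lt_trans.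
  by rewrite -raddfB; exact: abs_Re_le_normc.
have /cvgrPdist_lt/(_ e%:C) : f s @[s --> t] --> f t by exact: f_cont.
rewrite ltcR => /(_ e_gt0); apply: filterS => s /=.
rewrite normr_normc ltcR; apply: le_lt_trans.
by rewrite -raddfB; exact: abs_Im_le_normc.
Qed.

Lemma real_complex_continuous (R : realType) (T : topologicalType) (w : T -> R) :
  continuous w -> continuous (fun t => (w t)%:C : R[i]^o).
Proof.
(* The tolerance is an element of [R[i]]; being positive, it has imaginary part 0. *)
move=> w_cont t; apply/cvgrPdist_lt => -[e e'].
rewrite ltcE /= => /andP[/eqP -> e_gt0].
have /cvgrPdist_lt/(_ e e_gt0) : w s @[s --> t] --> w t by exact: w_cont.
apply: filterS => s /=.
by rewrite -raddfB/= normc_def/= expr0n addr0 sqrtr_sqr ltcR.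
Qed.

(** As [w] is real, the real and imaginary parts of the product are weighted averages of those of
    [a]. Each contributes [e + M * eta], and the modulus is at most the sum of the two. *)
Lemma kernel_mul_weight_error (R : realType) (X : ptopologicalType)
    (m : probability (borel X) R) (a : X * X -> R[i]^o) (w : X * X -> R)
    (e eta M : R) (x y : X) :
  compact [set: X] -> continuous a -> continuous w -> (forall p, 0 <= w p) ->
  0 <= e ->
  (forall z, w (z, y) != 0 ->
    `|complex.Re (a (x, z)) - complex.Re (a (x, y))| <= e /\
    `|complex.Im (a (x, z)) - complex.Im (a (x, y))| <= e) ->
  `|complex.Re (a (x, y))| <= M -> `|complex.Im (a (x, y))| <= M ->
  1 - eta <= \int[m]_(z in [set: borel X]) w (z, y) <= 1 ->
  Normc.normc ((kernel_mul m a (fun p => (w p)%:C) \- a) (x, y)) <=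
    (e + M * eta) *+ 2.
Proof.
move=> X_compact a_cont w_cont w_ge0 e_ge0 a_near Re_M Im_M w_int.
have [Re_cont Im_cont] := Re_Im_continuous a_cont.
have left_section (f : X * X -> R) : continuous f -> continuous (fun z => f (x, z)).
  move=> f_cont z; apply: (@continuous_comp _ _ _ (fun z => (x, z)) f); last exact: f_cont.
  by apply: cvg_pair; [exact: cvg_cst|exact: cvg_id].
have wy_cont : continuous (fun z => w (z, y)).
  move=> z; apply: (@continuous_comp _ _ _ (fun z => (z, y)) w); last exact: w_cont.
  by apply: cvg_pair; [exact: cvg_id|exact: cvg_cst].
apply: le_trans (normc_le_abs_Re_Im _) _.
rewrite mulr2n /kernel_mul /Cintegral; apply: lerD.
  rewrite raddfB/=.
  have -> : \int[m]_z complex.Re (a (x, z) * (w (z, y))%:C) =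
      \int[m]_z (complex.Re (a (x, z)) * w (z, y)).
    apply: eq_Rintegral => z _; case: (a _) => b c /=.
    by rewrite mulr0 subr0.
  apply: weighted_average_error => //.
    exact: left_section Re_cont.
  by move=> z /a_near[].
rewrite raddfB/=.
have -> : \int[m]_z complex.Im (a (x, z) * (w (z, y))%:C) =
    \int[m]_z (complex.Im (a (x, z)) * w (z, y)).
  apply: eq_Rintegral => z _; case: (a _) => b c /=.
  by rewrite mulr0 add0r.
apply: weighted_average_error => //.
  exact: left_section Im_cont.
by move=> z /a_near[].
Qed.

Lemma kernel_mul_weight_cvg (R : realType) (X : ptopologicalType)
    (m : probability (borel X) R) (d : X -> X -> R) (delta eta : nat -> R)
    (w : nat -> X * X -> R) (a : X * X -> R[i]^o) (e : R) :
  compact [set: X] -> compatible_metric d ->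
  delta n @[n --> \oo] --> (0 : R) -> eta n @[n --> \oo] --> (0 : R) ->
  (forall n, is_weight m d (delta n) (eta n) (w n)) ->
  continuous a -> 0 < e ->
  \forall n \near \oo, forall p,
    Normc.normc ((kernel_mul m a (fun q => (w n q)%:C) \- a) p) <= e.
Proof.
move=> X_compact dP delta0 eta0 wP a_cont e_gt0.
have [Re_cont Im_cont] := Re_Im_continuous a_cont.
have XX_compact : compact [set: X * X].
  by rewrite -setXTT; exact: compact_setX.
have [M1 M1_ge0 Re_M] := compact_continuous_bounded XX_compact Re_cont.
have [M2 M2_ge0 Im_M] := compact_continuous_bounded XX_compact Im_cont.
pose M := M1 + M2.
(* Four errors add up to [e]: oscillation and defect of mass, each for the real and the imaginary
   part. *)
have e4_gt0 : 0 < e / 4 by rewrite divr_gt0.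
have [r1 r1_gt0 Re_near] := uniformly_continuous_snd X_compact dP Re_cont e4_gt0.
have [r2 r2_gt0 Im_near] := uniformly_continuous_snd X_compact dP Im_cont e4_gt0.
have Meta0 : M * eta n @[n --> \oo] --> (0 : R).
  by rewrite -(mulr0 M); apply: cvgM => //; exact: cvg_cst.
near=> n => -[x y].
have [w_cont w_ge0 w_sym w_near w_int] := wP n.
have delta_r1 : delta n < r1 by near: n; exact: (cvgr_lt 0).
have delta_r2 : delta n < r2 by near: n; exact: (cvgr_lt 0).
have Meta : M * eta n < e / 4 by near: n; exact: (cvgr_lt 0).
apply: (@le_trans _ _ ((e / 4 + M * eta n) *+ 2)); last first.
  by rewrite mulr2n; lra.
apply: kernel_mul_weight_error => //; first exact: ltW.
- move=> z /w_near zy; have yz : d y z < delta n.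
    by case: dP => -[_ _ d_sym _] _; rewrite d_sym.
  by split; [apply: Re_near|apply: Im_near]; exact: lt_trans yz _.
- by rewrite (le_trans (Re_M _))// lerDl.
- by rewrite (le_trans (Im_M _))// lerDr.
(* Right multiplication integrates over the first variable of the weight; symmetry gives the
   marginal that [w_int] controls. *)
- have -> : \int[m]_z w n (z, y) = \int[m]_z w n (y, z) by exact: eq_Rintegral.
  exact: w_int.
Unshelve. all: by end_near.
Qed.

(** The integrands already agree pointwise, by commutativity of [R[i]] and symmetry of [w]. *)
Lemma kernel_mul_transpose (R : realType) (X : ptopologicalType)
    (m : probability (borel X) R) (a : X * X -> R[i]) (w : X * X -> R) (x y : X) :
  (forall x y, w (x, y) = w (y, x)) ->
  kernel_mul m (fun q => (w q)%:C) a (x, y) =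
  kernel_mul m (fun q => a (q.2, q.1)) (fun q => (w q)%:C) (y, x).
Proof.
move=> w_sym; congr (Cintegral m); apply/funext => z /=.
by rewrite mulrC w_sym.
Qed.

Lemma sup_norm_cvg0 (R : realType) (X : ptopologicalType)
    (f : nat -> X * X -> R[i]) :
  (forall e : R, 0 < e ->
    \forall n \near \oo, forall p, Normc.normc (f n p) <= e) ->
  sup_norm (f n) @[n --> \oo] --> (0 : R).
Proof.
move=> f0; apply/cvgrPdist_le => e e_gt0.
apply: filterS (f0 e e_gt0) => n fn_e; rewrite sub0r normrN.
have norm_ub : ubound [set Normc.normc (f n p) | p in setT] e.
  by move=> _ [p _ <-]; exact: fn_e.
(* The supremum is nonnegative because it dominates the modulus at [point]. *)
rewrite ger0_norm; last first.
  apply: (@le_trans _ _ (Normc.normc (f n point))).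
    exact: le_trans (normr_ge0 _) (abs_Re_le_normc _).
  by apply: ub_le_sup; [exists e|exists point].
by apply: ge_sup => //; exists (Normc.normc (f n point)); exists point.
Qed.

(** * Assembly of the approximate unit, a net indexed by [nat] *)

Theorem theorem3p9 (R : realType) (X : ptopologicalType)
    (m : probability (borel X) R)
    (X_compact : compact [set: X])
    (X_metrizable : metrizable R X)
    (m_support : measure_support m = [set: X])
    (condition : exists (d : X -> X -> R) (delta : nat -> R),
      [/\ compatible_metric d,
          nonincreasing_seq delta,
          forall n, 0 < delta n,
          inf (range delta) = 0 &
          (forall n x, m [set y | d x y = delta n] = 0%E) /\
          (forall n x y, m (mball d x (delta n)) = m (mball d y (delta n)))]) :
  exists (L : Type) (le : L -> L -> Prop)
    (u : L -> cont_kernel R X),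
    two_sided_approximate_unit m le u.
Proof.
have [d [delta [dP delta_decr delta_gt0 delta_inf [_ m_const]]]] := condition.
have delta0 : delta n @[n --> \oo] --> (0 : R).
  rewrite -delta_inf; apply: nonincreasing_cvgn => //.
  by exists 0 => _ [n _ <-]; exact: ltW.
(* The mass defect is allowed to be [1/(n+1)], so that it tends to 0 together with [delta n]. *)
have /choice[w wP] : forall n, exists w, is_weight m d (delta n) n.+1%:R^-1 w.
  by move=> n; apply: approximate_unit_weight.
have u_cont n : continuous (fun p => (w n p)%:C : R[i]^o).
  by apply: real_complex_continuous; case: (wP n).
pose u n : cont_kernel R X := HB.pack (fun p => (w n p)%:C : R[i]^o)
  (isContinuous.Build _ _ (fun p => (w n p)%:C : R[i]^o) (u_cont n)).
have right_unit (a : X * X -> R[i]^o) (e : R) : continuous a -> 0 < e ->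
    \forall n \near \oo, forall p,
      Normc.normc ((kernel_mul m a (fun q => (w n q)%:C) \- a) p) <= e.
  exact: (kernel_mul_weight_cvg X_compact dP delta0 (@cvg_harmonic R) wP).
(* The filter [\oo] on [nat] is by definition the one generated by the tails. *)
have tailsE : tails (fun i j : nat => (i <= j)%N) = \oo.
  by [].
exists nat, (fun i j => (i <= j)%N), u; split.
  split => //; first exact: (inhabits 0%N).
    by move=> i j k; exact: leq_trans.
  by move=> i j; exists (maxn i j); rewrite ?leq_maxl ?leq_maxr.
move=> a; rewrite tailsE; have a_cont : continuous a by exact: cts_fun.
split; apply: sup_norm_cvg0 => e e_gt0; first exact: right_unit.
have at_cont : continuous (fun q : X * X => a (q.2, q.1) : R[i]^o).
  move=> q; apply: (@continuous_comp _ _ _ (fun q : X * X => (q.2, q.1)) a).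
    by apply: cvg_pair; [exact: cvg_snd|exact: cvg_fst].
  exact: a_cont.
(* The bound for right products holds at all points, so for the transpose of [a] it can be read at
   [(y, x)]. *)
apply: filterS (right_unit _ _ at_cont e_gt0) => n right_n [x y].
have [_ _ w_sym _ _] := wP n.
rewrite /= [X in X - _](kernel_mul_transpose m a x y w_sym).
exact: (right_n (y, x)).
Qed.
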